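(* For each positive integer $r$ there is a positive integer $k$ such that, with probability tending to $1$ as $n\to\infty$, the random hypergraph $\mathcal{H}=\mathcal{K}^{(r)}_{n\times r}(k\text{-out})$ admits a perfect fractional matching, and every minimum weight fractional cover of $\mathcal{H}$ is constant on each block $V_i$ of the $r$-partition.
   Context: $\mathcal{K}^{(r)}_{n\times r}$ denotes the complete $r$-partite $r$-graph with vertex set $V=V_1\cup\cdots\cup V_r$ (disjoint, $|V_i|=n$ for each $i$), whose edges are all sets containing exactly one vertex from each $V_i$. The $k$-out model: for a host hypergraph $\mathcal{H}$ on $V$, the random subhypergraph $\mathcal{H}(k\text{-out})$ is $\bigcup_{v\in V}E_v$, where, for each $v$, $E_v$ is chosen uniformly at random from the $k$-element subsets of $\mathcal{H}_v=\{A\in\mathcal{H}: v\in A\}$ (or $E_v=\mathcal{H}_v$ if $|\mathcal{H}_v|<k$), independently over $v$. A fractional cover is a map $w:V\to[0,1]$ with $\sum_{v\in e}w(v)\ge1$ for every edge $e$; its weight is $\sum_v w(v)$. A fractional matching is a map $\varphi$ from edges to $[0,1]$ with $\sum_{e\ni v}\varphi(e)\le1$ for every vertex $v$; it is perfect if $\sum_{e\ni v}\varphi(e)=1$ for every vertex $v$ (equivalently, its weight $\sum_e\varphi(e)$ equals $|V|/r=n$). *)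

(* Defs.v *)
From mathcomp Require Import all_boot all_order all_algebra.
From mathcomp Require Import boolp classical_sets reals topology normedtype sequences.

Set Implicit Arguments.
Unset Strict Implicit.
Unset Printing Implicit Defensive.

Import Order.TTheory GRing.Theory Num.Theory.
Import numFieldNormedType.Exports.

Local Open Scope ring_scope.

(* A hypergraph on the finite vertex type V is its edge set H : {set {set V}}. *)

Section Fractional.
Variables (R : realType) (V : finType).
Implicit Types (H : {set {set V}}) (w : V -> R) (phi : {set V} -> R).

Definition weight w : R := \sum_(v : V) w v.

Definition fractional_cover H w : Prop :=
  (forall v, 0 <= w v <= 1) /\ (forall e, e \in H -> 1 <= \sum_(v in e) w v).

Definition min_weight_fractional_cover H w : Prop :=
  fractional_cover H w /\
  forall w' : V -> R, fractional_cover H w' -> weight w <= weight w'.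

(* Only the values of phi on the edges of H matter. *)
Definition fractional_matching H phi : Prop :=
  (forall e, e \in H -> 0 <= phi e <= 1) /\
  (forall v, \sum_(e in H | v \in e) phi e <= 1).

Definition perfect_fractional_matching H phi : Prop :=
  fractional_matching H phi /\
  (forall v, \sum_(e in H | v \in e) phi e = 1).

End Fractional.

Section KOut.
Variables (R : realType) (V : finType).
Implicit Types (H : {set {set V}}) (k : nat) (v : V).

Definition edges_at H v : {set {set V}} := [set A in H | v \in A].

Definition kout_choices H k v : {set {set {set V}}} :=
  if (#|edges_at H v| < k)%N then [set edges_at H v]
  else [set S : {set {set V}} | (S \subset edges_at H v) && (#|S| == k)].

(* The law of the set E_v chosen at v: uniform on kout_choices H k v. *)
Definition kout_choice_law H k v (S : {set {set V}}) : R :=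
  if S \in kout_choices H k v then (#|kout_choices H k v|%:R)^-1 else 0.

(* The joint law of the family (E_v)_v; the product expresses independence. *)
Definition kout_law H k (E : {ffun V -> {set {set V}}}) : R :=
  \prod_(v : V) kout_choice_law H k v (E v).

Definition kout_graph (E : {ffun V -> {set {set V}}}) : {set {set V}} :=
  \bigcup_(v : V) E v.

(* The probability that the random hypergraph H(k-out) satisfies P. *)
Definition kout_prob H k (P : {set {set V}} -> Prop) : R :=
  \sum_(E : {ffun V -> {set {set V}}} | `[< P (kout_graph E) >]) kout_law H k E.

End KOut.

(* The vertex (i, a) is the a-th vertex of the block V_i. *)
Definition complete_partite (r n : nat) : {set {set 'I_r * 'I_n}} :=
  [set A : {set 'I_r * 'I_n} |
    [forall i : 'I_r, #|[set x in A | x.1 == i]| == 1%N]].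

Definition constant_on_blocks (R : realType) (r n : nat)
    (w : 'I_r * 'I_n -> R) : Prop :=
  forall (i : 'I_r) (a b : 'I_n), w (i, a) = w (i, b).

(* Main.v *)
(* For large [k] the random hypergraph is, with high probability, expanding:
   (1) for every nonempty set [X] of at most [n/(4r)] vertices, every vertex
   set disjoint from [X] that meets all edges meeting [X] has at least [2r|X|]
   elements; (2) every vertex set occupying at least a fraction [1/(4r^2)] of
   each block contains an edge. Both follow from union bounds, as the edges
   chosen at [v] all miss a given set with probability exponentially small in [k].
   Expansion forces every fractional cover to have weight at least [n], with
   equality only for covers constant on blocks. A perfect fractional matching
   then comes without linear-programming duality: minimise [|y|^2] over the
   probability vectors on edges, [y] being the vector of vertex loads; at the
   minimum [y / |y|^2] is a cover of weight [r / |y|^2], so [|y|^2 <= r / n],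
   and Cauchy-Schwarz makes [y] constant. *)
Require Import Defs.
From mathcomp Require Import all_boot all_order all_algebra.
From mathcomp Require Import boolp classical_sets reals topology normedtype sequences.
From mathcomp Require Import derive zify ring lra.

Set Implicit Arguments.
Unset Strict Implicit.
Unset Printing Implicit Defensive.

Import Order.TTheory GRing.Theory Num.Theory.
Import numFieldNormedType.Exports.

Local Open Scope ring_scope.

(** * Layer-cake comparison, intermediate subsets and quantiles *)

(** Induction on the support of [g]: lowering both functions by the least positive value [g m], cut
    off at [0], keeps the hypothesis, since level [t] becomes level [t + g m], and drops [m] from
    the support. The slab removed is compared by the hypothesis at [g m]. *)
Lemma layer_cake_le (R : realFieldType) (V : finType) (C : nat) (g h : V -> R) :
  (forall v, 0 <= g v) -> (forall v, 0 <= h v) ->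
  (forall t : R, 0 < t ->
     (C * #|[set v | (t <= g v)%R]| <= #|[set v | (t <= h v)%R]|)%N) ->
  C%:R * (\sum_v g v) <= \sum_v h v.
Proof.
have [N] := ubnP #|[set v | 0 < g v]|.
elim: N g h => // N IHN g h ltN g0 h0 gh.
have [supp0|[v0]] := set_0Vmem [set v | 0 < g v].
  rewrite [X in _ * X]big1 ?mulr0 ?sumr_ge0// => v _.
  apply/eqP; rewrite eq_le g0 andbT leNgt.
  by have := finset.in_set0 v; rewrite -supp0 inE => ->.
rewrite inE => gv0.
have [m mpos mmin] := @arg_minP _ _ _ v0 (fun v => 0 < g v) g gv0.
pose cut (k : V -> R) v := if g m <= k v then k v - g m else 0.
have cut0 k v : 0 <= cut k v by rewrite /cut; case: ifP => // ?; rewrite subr_ge0.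
have cutE k (t : R) : 0 < t -> [set v | t <= cut k v] = [set v | t + g m <= k v].
  move=> t0; apply/setP => v; rewrite !inE /cut.
  case: ifPn => [_|]; first by rewrite lerBrDr.
  rewrite -ltNge => kv; rewrite !leNgt t0/=; apply/esym/negbTE; rewrite negbK.
  by apply: lt_trans kv _; rewrite ltrDr.
have IH : C%:R * (\sum_v cut g v) <= \sum_v cut h v.
  apply: IHN => // [|t t0]; last first.
    by rewrite !cutE//; apply: gh; apply: addr_gt0.
  apply: leq_trans (_ : #|[set v | (0 < g v)%R]| <= _)%N; last by rewrite -ltnS.
  apply/proper_card/properP; split.
    apply/fintype.subsetP => v; rewrite !inE /cut; case: ifP => [le _|]; last by rewrite ltxx.
    exact: lt_le_trans le.
  by exists m; rewrite ?inE// /cut lexx subrr ltxx.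
have sumcut (k : V -> R) : \sum_v (g m *+ (g m <= k v)%R) = g m * #|[set v | g m <= k v]|%:R.
  rewrite -sum1_card natr_sum mulr_sumr [RHS]big_mkcond/=.
  by apply: eq_bigr => v _; rewrite inE mulr1; case: ifP.
have -> : \sum_v g v = \sum_v cut g v + g m * #|[set v | g m <= g v]|%:R.
  rewrite -sumcut -big_split; apply: eq_bigr => v _ /=.
  rewrite /cut; case: ifPn => [_|lt]; first by rewrite subrK.
  rewrite addr0; apply/eqP; rewrite eq_le g0 andbT leNgt.
  by apply: contra lt => /mmin.
apply: le_trans (_ : \sum_v cut h v + g m * #|[set v | g m <= h v]|%:R <= _).
  rewrite mulrDr lerD// mulrCA ler_wpM2l// -natrM ler_nat; exact: gh.
rewrite -sumcut -big_split ler_sum// => v _ /=.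
by rewrite /cut; case: ifP => [_|_]; rewrite ?subrK// addr0.
Qed.

Lemma exists_card_between (T : finType) (X B : {set T}) m :
  X \subset B -> (#|X| <= m <= #|B|)%N ->
  exists A : {set T}, [/\ X \subset A, A \subset B & #|A| = m].
Proof.
move=> XB /andP[Xm mB]; rewrite -(subnKC Xm) in mB *.
elim: (m - #|X|)%N mB => [|d IHd] dB; first by exists X; rewrite addn0.
have [|A [XA AB cA]] := IHd; first by apply: leq_trans dB; rewrite leq_add2l.
have /properP[_ [b bB bA]] : A \proper B by rewrite properEcard AB cA -addnS.
exists (b |: A); split; first exact: fintype.subset_trans XA (finset.subsetU1 _ _).
  by rewrite finset.subUset finset.sub1set bB.
by rewrite cardsU1 bA cA addnS.
Qed.

(** Choose [b] with [w b] least among the indices whose sublevel set has at least [n / M] elements.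
    A strict sublevel set larger than [n / M] would have a maximal element that is a smaller
    candidate. *)
Lemma quantile (R : realDomainType) (n M : nat) (w : 'I_n -> R) :
  (0 < n)%N -> (0 < M)%N ->
  exists b, (M * #|[set a | (w a < w b)%R]| <= n)%N /\
            (n <= M * #|[set a | (w a <= w b)%R]|)%N.
Proof.
move=> n0 M0; pose P b := (n <= M * #|[set a | (w a <= w b)%R]|)%N.
have [b0 _ b0max] := @arg_maxP _ _ _ (Ordinal n0) xpredT w isT.
have Pb0 : P b0.
  rewrite /P (_ : [set a | (w a <= w b0)%R] = [set: 'I_n]%SET) ?cardsT ?card_ord ?leq_pmull//.
  by apply/setP => a; rewrite !inE; exact: b0max.
have [b Pb bmin] := @arg_minP _ _ _ b0 P w Pb0.
exists b; split=> //.
have [->|[c0]] := set_0Vmem [set a | (w a < w b)%R]; first by rewrite cards0 muln0.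
rewrite inE => c0b.
have [c cb cmax] := @arg_maxP _ _ _ c0 (fun a => w a < w b) w c0b.
rewrite leqNgt; apply/negP => ltn.
suff /bmin : P c by rewrite leNgt cb.
apply: leq_trans (ltnW ltn) _; rewrite leq_mul2l subset_leq_card ?orbT//.
by apply/fintype.subsetP => a; rewrite !inE; exact: cmax.
Qed.

(** * Perfect fractional matchings from a lower bound on cover weights *)

Lemma simplex_min (R : realType) (N : nat) (F : 'rV[R]_N -> R) :
  (0 < N)%N -> continuous F ->
  exists p : 'rV[R]_N, [/\ forall j, 0 <= p ord0 j, \sum_j p ord0 j = 1 &
    forall q : 'rV[R]_N, (forall j, 0 <= q ord0 j) -> \sum_j q ord0 j = 1 ->
      F p <= F q].
Proof.
move=> N0 cF.
pose cube := [set q : 'rV[R]_N | forall j, `[(0:R), 1]%classic (q ord0 j)]%classic.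
pose A := (cube `&` [set q : 'rV[R]_N | \sum_j q ord0 j = 1])%classic.
have inA (q : 'rV[R]_N) : (forall j, 0 <= q ord0 j) -> \sum_j q ord0 j = 1 -> A q.
  move=> q0 q1; split=> // j /=; rewrite in_itv/= q0/= -q1 (bigD1 j)//= lerDl.
  by rewrite sumr_ge0.
have A0 : (A !=set0)%classic.
  exists (\row_j (j == Ordinal N0)%:R); apply: inA => [j|]; first by rewrite mxE.
  by rewrite (bigD1 (Ordinal N0))//= mxE eqxx big1 ?addr0// => j /negbTE jn; rewrite mxE jn.
have cS : continuous (fun q : 'rV[R]_N => \sum_j q ord0 j).
  apply: continuous_big => [|j _]; [exact: add_continuous|exact: coord_continuous].
have cA : compact A.
  apply: compact_closedI.
    apply: (@rV_compact _ _ (fun=> `[(0:R), 1]%classic)) => _.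
    exact: segment_compact.
  by apply: (preimage_closed _ (@closed_eq _ _)) => q _; exact: cS.
have [p pA pmin] := EVT_min_rV A0 cA (continuous_subspaceT cF).
move: pA; rewrite inE => -[p01 p1]; exists p; split=> //.
  by move=> j; have := p01 j; rewrite /= in_itv/= => /andP[].
by move=> q q0 q1; apply: pmin; rewrite inE; exact: inA.
Qed.

Lemma fractional_duality (R : realType) (V : finType) (H : {set {set V}}) (r : nat) :
  (0 < #|V|)%N -> (0 < r)%N -> (forall e, e \in H -> #|e| = r) ->
  (forall w : V -> R, fractional_cover H w -> #|V|%:R / r%:R <= weight w) ->
  exists phi : {set V} -> R, perfect_fractional_matching H phi.
Proof.
move=> V0 r0 Hr cover_ge.
have Vr0 : 0 < #|V|%:R :> R by rewrite ltr0n.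
have rr0 : 0 < r%:R :> R by rewrite ltr0n.
have H0 : (0 < #|H|)%N.
  rewrite lt0n; apply/eqP => /cards0_eq HE.
  have : fractional_cover H (fun _ => 0 : R).
    by split=> [v|e]; [rewrite lexx ler01|rewrite HE inE].
  by move=> /cover_ge; rewrite /weight big1// leNgt divr_gt0.
pose inc (j : 'I_#|H|) v : R := (v \in enum_val j)%:R.
pose y (p : 'rV[R]_#|H|) v := \sum_j p ord0 j * inc j v.
have cy v : continuous (y^~ v).
  apply: continuous_big => [|j _]; first exact: add_continuous.
  by move=> p; apply: (@continuousM _ _ (fun p : 'rV[R]_#|H| => p ord0 j) (fun=> inc j v));
    [exact: coord_continuous|exact: cst_continuous].
have cF : continuous (fun p => \sum_v y p v ^+ 2).
  apply: continuous_big => [|v _]; first exact: add_continuous.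
  by move=> p; apply: (@continuousM _ _ (y^~ v) (y^~ v)); exact: cy.
have [p [p0 p1 pmin]] := simplex_min H0 cF.
have inc_sum j : \sum_v inc j v = r%:R.
  by rewrite -(Hr _ (enum_valP j)) -sum1_card natr_sum [RHS]big_mkcond/=;
    apply: eq_bigr => v _; rewrite /inc; case: ifP.
have y0 v : 0 <= y p v by apply: sumr_ge0 => j _; rewrite mulr_ge0// ler0n.
have ysum : \sum_v y p v = r%:R.
  transitivity (\sum_j p ord0 j * r%:R); last by rewrite -mulr_suml p1 mul1r.
  rewrite exchange_big/=.
  by apply: eq_bigr => j _; rewrite -mulr_sumr inc_sum.
pose Q := \sum_v y p v ^+ 2.
(* First-order optimality of [p] in the direction of the [j]-th vertex of the simplex. *)
have opt j : Q <= \sum_v y p v * inc j v.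
  pose I1 := \sum_v y p v * inc j v; pose I2 := \sum_v inc j v ^+ 2.
  (* Minimality of [p] against [(1 - t) p + t e_j], with the common factor [t] divided out. *)
  have ineq t : 0 < t <= 1 -> 0 <= 2 * (I1 - Q) + t * (Q - 2 * I1 + I2).
    move=> /andP[t0 t1]; pose q : 'rV[R]_#|H| := \row_i ((1 - t) * p ord0 i + t * (i == j)%:R).
    have yq v : y q v = (1 - t) * y p v + t * inc j v.
      rewrite /y (eq_bigr (fun i => (1 - t) * (p ord0 i * inc i v) + t * ((i == j)%:R * inc
        i v))).
        rewrite big_split/= -!mulr_sumr; congr (_ + _ * _).
        by rewrite (bigD1 j)//= eqxx mul1r big1 ?addr0// => i /negbTE ->; rewrite mul0r.
      by move=> i _; rewrite mxE; ring.
    have := pmin q; rewrite -/Q.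
    have -> : \sum_v y q v ^+ 2 = (1 - t) ^+ 2 * Q + 2 * t * (1 - t) * I1 + t ^+ 2 * I2.
      rewrite /Q /I1 /I2 !mulr_sumr -!big_split/=; apply: eq_bigr => v _.
      by rewrite yq; ring.
    move=> le.
    have {}le : Q <= (1 - t) ^+ 2 * Q + 2 * t * (1 - t) * I1 + t ^+ 2 * I2.
      apply: le => [i|].
        by rewrite mxE addr_ge0// mulr_ge0// ?ler0n// ?subr_ge0// ltW.
      rewrite (eq_bigr (fun i => (1 - t) * p ord0 i + t * (i == j)%:R)) => [|i _];
        last by rewrite mxE.
      rewrite big_split/= -!mulr_sumr p1 (bigD1 j)//= eqxx big1 => [|i /negbTE ->//].
      rewrite mulr1 addr0 mulr1; lra.
    rewrite -(pmulr_rge0 _ t0); move: le; rewrite -subr_ge0 => /le_trans; apply.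
    by rewrite le_eqVlt; apply/orP; left; apply/eqP; ring.
  rewrite leNgt; apply/negP => lt; rewrite -/I1 in lt.
  (* If [I1 < Q], this [t] is small enough that the quadratic term cannot offset the linear one; the
     maximum keeps the divisor [B] positive. *)
  pose B := Num.max 1 (Q - 2 * I1 + I2).
  pose t := Num.min 1 ((Q - I1) / B).
  have B1 : 1 <= B by rewrite le_max lexx.
  have B0 : 0 < B by rewrite (lt_le_trans ltr01).
  have t01 : 0 < t <= 1.
    by rewrite lt_min ltr01 divr_gt0 ?subr_gt0//= ge_min lexx.
  have := ineq t t01; have [t0 _] := andP t01.
  have tB : t * (Q - 2 * I1 + I2) <= Q - I1.
    apply: (@le_trans _ _ (t * B)); first by rewrite ler_wpM2l ?(ltW t0)// le_max lexx orbT.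
    by rewrite -ler_pdivlMr// ge_min lexx orbT.
  by lra.
have [j0] : exists j : 'I_#|H|, true by exists (Ordinal H0).
have Q0 : 0 < Q.
  rewrite lt_neqAle; apply/andP; split; last by apply: sumr_ge0 => v _; exact: sqr_ge0.
  apply/eqP => Q0; move: ysum; rewrite big1 => [/eqP|v _].
    by rewrite eq_sym gt_eqF.
  apply/eqP; rewrite -sqrf_eq0; apply/eqP.
  by apply: (@psumr_eq0P _ _ xpredT (fun v => y p v ^+ 2)) => // u _; exact: sqr_ge0.
(* Truncation keeps [w] within [[0, 1]]; an edge containing a truncated vertex is covered by that
   vertex alone, any other edge by [opt]. *)
pose w v := Num.min 1 (y p v / Q).
have wc : fractional_cover H w.
  split=> [v|e eH].
    by rewrite le_min ler01 divr_ge0 ?(ltW Q0)//= ge_min lexx.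
  have [/existsP[v /andP[ve yv]]|] := boolP [exists v, (v \in e) && (1 <= y p v / Q)].
    rewrite (bigD1 v)//= {1}/w min_l// lerDl sumr_ge0// => u _.
    by rewrite le_min ler01 divr_ge0 ?(ltW Q0).
  rewrite negb_exists => /forallP small.
  rewrite (eq_bigr (fun v => y p v / Q)) => [|v ve]; last first.
    by have := small v; rewrite ve/= -ltNge => lt; rewrite /w min_r// ltW.
  rewrite -mulr_suml ler_pdivlMr// mul1r.
  have := opt (enum_rank_in eH e); rewrite /inc enum_rankK_in// => /le_trans; apply.
  rewrite [X in _ <= X]big_mkcond/= ler_sum// => v _.
  by case: ifP => _; rewrite ?mulr1// mulr0.
have Qle : Q <= r%:R ^+ 2 / #|V|%:R.
  have : weight w <= r%:R / Q.
    by rewrite -ysum mulr_suml ler_sum// => v _; rewrite ge_min lexx orbT.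
  move=> /(le_trans (cover_ge _ wc)).
  rewrite ler_pdivlMr// mulrAC ler_pdivrMr// => le.
  by rewrite ler_pdivlMr// mulrC expr2.
pose c : R := r%:R / #|V|%:R.
(* Equality case of Cauchy-Schwarz: since [c * #|V| = r], this sum is [Q - r * c], which [Qle] makes
   nonpositive. *)
have var0 : \sum_v (y p v - c) ^+ 2 <= 0.
  rewrite (eq_bigr (fun v => y p v ^+ 2 + (- (2 * c)) * y p v + c ^+ 2));
    last by move=> v _; ring.
  rewrite !big_split/= -mulr_sumr ysum sumr_const -/Q -(mulr_natr (c ^+ 2)) cardT -cardE.
  have cE : c * #|V|%:R = r%:R by rewrite /c divfK// gt_eqF.
  have : Q <= r%:R * c by apply: le_trans Qle _; rewrite expr2 -mulrA.
  by rewrite expr2 -mulrA cE; lra.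
have yE v : y p v = c.
  apply/eqP; rewrite -subr_eq0 -sqrf_eq0; apply/eqP.
  apply: (@psumr_eq0P _ _ xpredT (fun v => (y p v - c) ^+ 2)) => // [u _|];
    first exact: sqr_ge0.
  by apply/eqP; rewrite eq_le var0/= sumr_ge0// => u _; exact: sqr_ge0.
have c0 : 0 < c by rewrite divr_gt0.
(* Division by [c] turns every load into [1]; the sum has one term when [e] is an edge and none
   otherwise. *)
pose phi e := \sum_(j | enum_val j == e) p ord0 j / c.
have phi0 e : 0 <= phi e by apply: sumr_ge0 => j _; rewrite divr_ge0// ltW.
have phisum v : \sum_(e in H | v \in e) phi e = 1.
  transitivity (y p v / c); last by rewrite yE divff// gt_eqF.
  rewrite mulr_suml [RHS](partition_big enum_val (mem H))/=; last by move=> j _;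
    exact: enum_valP.
  rewrite [LHS]big_mkcondr/=; apply: eq_bigr => e eH; rewrite /phi.
  case: ifPn => ve.
    by apply: eq_bigr => j /eqP je; rewrite /inc je ve mulr1.
  by rewrite big1 // => j /eqP je; rewrite /inc je (negbTE ve) mulr0 mul0r.
exists phi; split=> //; split=> [e eH|v]; last by rewrite phisum.
rewrite phi0/=; have /card_gt0P[v ve] : (0 < #|e|)%N by rewrite Hr.
rewrite -(phisum v) (bigD1 e) ?eH//= lerDl sumr_ge0// => *.
Qed.

(** * Expansion and fractional covers *)

(* The [X], [A] for which some edge meeting [X] must lie inside [A]: either [X]
   is small and the complement of [A] has exactly [2r|X|] elements, or [A = X]
   occupies a fraction at least [1/(4r^2)] of every block. *)
Definition critical (r n : nat) (X A : {set 'I_r * 'I_n}) : bool :=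
  (X \subset A) &&
  ([&& X != finset.set0, 4 * r * #|X| <= n & #|~: A| == 2 * r * #|X|]
   || (X == A) && [forall i, n <= 4 * r ^ 2 * #|[set a | (i, a) \in A]|])%N.

(** For small [X] this is the blocking-set property in contrapositive form, [~: A] being the
    blocking set; smaller blocking sets can be padded to the size that [critical] fixes. *)
Definition expanding (r n : nat) (H : {set {set 'I_r * 'I_n}}) : Prop :=
  forall X A : {set 'I_r * 'I_n}, critical X A ->
    exists e v, [/\ e \in H, v \in e, v \in X & e \subset A].

Lemma sum_transversal (R : nzRingType) (r n : nat) (e : {set 'I_r * 'I_n}) (F : 'I_r -> R) :
  e \in complete_partite r n -> \sum_(x in e) F x.1 = \sum_i F i.
Proof.
rewrite inE => /forallP eP; rewrite (partition_big fst xpredT)//=.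
apply: eq_bigr => i _; rewrite (eq_bigr (fun _ => F i)) => [|x /andP[_ /eqP->]//].
rewrite sumr_const (_ : #|_| = 1%N) ?mulr1n// -(eqP (eP i)).
by apply: eq_card => x; rewrite !inE.
Qed.

Lemma card_transversal (r n : nat) (e : {set 'I_r * 'I_n}) :
  e \in complete_partite r n -> #|e| = r.
Proof.
move=> eK; have := @sum_transversal int r n e (fun=> 1) eK.
by rewrite !sumr_const card_ord => /eqP; rewrite eqr_nat => /eqP.
Qed.

Lemma card_blocks (r n : nat) (L : {set 'I_r * 'I_n}) :
  #|L| = (\sum_i #|[set a | (i, a) \in L]|)%N.
Proof.
rewrite -sum1_card big_mkcond/=.
rewrite (eq_bigr (fun x => if (x.1, x.2) \in L then 1 else 0)%N) => [|[]//].
rewrite -(pair_bigA _ (fun i a => if (i, a) \in L then 1 else 0)%N)/=.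
apply: eq_bigr => i _; rewrite -sum1_card [RHS]big_mkcond/=.
by apply: eq_bigr => a _; rewrite inE.
Qed.

Section ExpandingCover.

Variables (R : realType) (r n : nat) (H : {set {set 'I_r * 'I_n}}).
Hypotheses (r0 : (0 < r)%N) (n0 : (0 < n)%N).
Hypotheses (HK : H \subset complete_partite r n) (Hexp : expanding H).

(* In each block let [a i] be a quantile of [w]; put [s = \sum_i a i - 1 >= 0]
   and [f x = w x - a x.1], so that [weight w - n = \sum_x f x + n * s].
   Edges give [\sum_(x in e) f x >= - s], so the edges at vertices with
   [f <= - s - t] must meet [f >= t / r]; expansion and the layer-cake formula
   then make the positive part of [f] dominate its negative part. *)
Lemma expanding_cover_weight (w : 'I_r * 'I_n -> R) :
  fractional_cover H w ->
  n%:R <= weight w /\ (weight w = n%:R -> constant_on_blocks w).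
Proof.
move=> [_ wH].
have M0 : (0 < 4 * r ^ 2)%N by rewrite muln_gt0 expn_gt0 r0.
have [b bP] := fin_all_exists (fun i => quantile (fun c => w (i, c)) n0 M0).
pose a i := w (i, b i); pose s := \sum_i a i - 1.
pose f x := w x - a x.1.
(* By the choice of quantiles [A] is critical with itself, so it contains an edge; the weight of
   that edge is at least [1], and at most [\sum_i a i] because [w <= a] on [A]. *)
have s0 : 0 <= s.
  pose A := [set x | w x <= a x.1].
  have [|e [v [eH _ _ eA]]] := Hexp (X := A) (A := A).
    rewrite /critical fintype.subxx eqxx/=; apply/orP; right; apply/forallP => i.
    apply: leq_trans (proj2 (bP i)) _; rewrite leq_mul2l; apply/orP; right.
    by apply/subset_leq_card/fintype.subsetP => c; rewrite !inE.
  rewrite subr_ge0; apply: le_trans (wH e eH) _.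
  rewrite -(sum_transversal a (fintype.subsetP HK _ eH)) ler_sum// => x xe.
  by have := fintype.subsetP eA _ xe; rewrite inE.
have fe e : e \in H -> - s <= \sum_(x in e) f x.
  move=> eH; rewrite sumrB (sum_transversal a (fintype.subsetP HK _ eH)).
  by rewrite /s opprB lerD2r wH.
have rr0 : 0 < r%:R :> R by rewrite ltr0n.
pose low := [set x | w x < a x.1].
have lown : (4 * r * #|low| <= n)%N.
  have : (4 * r ^ 2 * #|low| <= r * n)%N.
    rewrite card_blocks big_distrr/= -[X in (_ <= X * _)%N]card_ord -sum_nat_const.
    apply: leq_sum => i _; apply: leq_trans (proj1 (bP i)); rewrite leq_mul2l; apply/orP;
      right.
    by apply/subset_leq_card/fintype.subsetP => c; rewrite !inE.
  by rewrite -[X in (X <= _)%N -> _](_ : r * (4 * r * #|low|) = _)%N ?leq_pmul2l//; ring.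
(* [g] is the excess of [- f] over [s]; the factor [r] in [h] turns the threshold [t / r] on [f]
   into [t]. *)
pose g x := Num.max 0 (- f x - s); pose h x := r%:R * Num.max 0 (f x).
have g0 x : 0 <= g x by rewrite le_max lexx.
have h0 x : 0 <= h x by rewrite mulr_ge0 ?(ltW rr0)// le_max lexx.
have gh (t : R) : 0 < t ->
    (2 * r * #|[set x | (t <= g x)%R]| <= #|[set x | (t <= h x)%R]|)%N.
  move=> t0; set X := [set x | t <= g x]; set U := [set x | t <= h x].
  rewrite leqNgt; apply/negP => ltU.
  have XP x : x \in X -> f x <= - s - t.
    by rewrite inE le_max leNgt t0/= => ?; lra.
  have UP x : x \notin U -> Num.max 0 (f x) < t / r%:R.
    by rewrite inE -ltNge /h mulrC ltr_pdivlMr.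
  have Xlow : X \subset low.
    by apply/fintype.subsetP => x /XP fx; rewrite inE -subr_lt0 -/(f x); lra.
  have Xn : (4 * r * #|X| <= n)%N.
    by apply: leq_trans lown; rewrite leq_mul2l subset_leq_card// orbT.
  have XU : X \subset ~: U.
    apply/fintype.subsetP => x /XP fx; rewrite !inE -ltNge /h max_l ?mulr0//; lra.
  (* [U] is padded to exactly [2r|X|] vertices outside [X]; [4r|X| <= n] leaves room for this. *)
  have [|A [XA AU cA]] := @exists_card_between _ X (~: U) (r * n - 2 * r * #|X|) XU.
    have := cardsC U; rewrite card_prod !card_ord; nia.
  have cAC : #|~: A| = (2 * r * #|X|)%N.
    have := cardsC A; rewrite card_prod !card_ord; nia.
  have [|e [v [eH ve vX eA]]] := Hexp (X := X) (A := A).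
    rewrite /critical XA Xn cAC eqxx/= andbT; apply/orP; left.
    by apply: contraTN ltU => /eqP ->; rewrite cards0 muln0.
  have eK := fintype.subsetP HK _ eH.
  (* Raising [f v] by [s + t] makes it nonpositive, so each of the [r] terms is below [t / r]; the
     sum of [f] over [e] then falls below [- s], against [fe]. *)
  have : \sum_(x in e) (f x + (x == v)%:R * (s + t)) < \sum_(x in e) t / r%:R.
    apply: ltr_sum.
      by apply/hasP; exists v => //; rewrite mem_index_enum.
    move=> x xe; have := UP x; rewrite -finset.in_setC =>
      /(_ (fintype.subsetP AU _ (fintype.subsetP eA _ xe))).
    have [->|_ lt] := eqVneq x v; last by rewrite mul0r addr0; apply: le_lt_trans lt;
      rewrite le_max lexx orbT.
    move=> _; have := XP v vX; have := divr_gt0 t0 rr0; rewrite mul1r; lra.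
  have ev1 : \sum_(x in e) (x == v)%:R = 1 :> R.
    by rewrite (bigD1 v)//= eqxx big1 ?addr0// => x /andP[_ /negbTE->].
  rewrite big_split/= -mulr_suml ev1 mul1r.
  rewrite sumr_const (card_transversal eK) -(mulr_natr (t / r%:R)) divfK ?gt_eqF//.
  by have := fe e eH; lra.
have := layer_cake_le g0 h0 gh; rewrite natrM => lc.
have lowR : 4 * #|low|%:R <= n%:R :> R.
  rewrite -natrM ler_nat; apply: leq_trans lown.
  by rewrite leq_mul2r leq_pmulr// orbT.
have fge x : h x / r%:R - g x - s * (x \in low)%:R <= f x.
  rewrite /h mulrAC divff ?gt_eqF// mul1r /g inE -subr_lt0 -/(f x).
  case: (ltP (f x) 0) => fx.
    rewrite /= mulr1.
    have : - f x - s <= Num.max 0 (- f x - s) by rewrite le_max lexx orbT.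
    lra.
  rewrite /= mulr0 subr0; have := g0 x; rewrite /g; lra.
pose S := \sum_x h x.
have S0 : 0 <= S by rewrite sumr_ge0.
have wE : weight w = \sum_x f x + n%:R * (s + 1).
  have -> : n%:R * (s + 1) = \sum_(x : 'I_r * 'I_n) a x.1.
    rewrite /s subrK -(pair_big xpredT xpredT (fun i _ => a i))/= mulr_sumr.
    by apply: eq_bigr => i _; rewrite sumr_const card_ord mulr_natl.
  by rewrite -big_split/=; apply: eq_bigr => x _; rewrite subrK.
have fsum : S / r%:R - \sum_x g x - s * #|low|%:R <= \sum_x f x.
  have -> : s * #|low|%:R = \sum_x s * (x \in low)%:R.
    rewrite -mulr_sumr -sum1_card natr_sum [in LHS]big_mkcond/=; congr (_ * _).
    by apply: eq_bigr => x _; case: ifP.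
  by rewrite /S mulr_suml -!sumrB ler_sum.
have gS : 2 * \sum_x g x <= S / r%:R.
  by rewrite ler_pdivlMr// mulrAC.
have SR : 0 <= S / r%:R by rewrite divr_ge0 ?(ltW rr0).
have ns : 0 <= s * n%:R by rewrite mulr_ge0.
have sl : 4 * (s * #|low|%:R) <= s * n%:R by rewrite mulrCA ler_wpM2l.
(* Together these give [weight w - n >= S / (2r) + (3/4) s n]. Equality thus forces [S = 0] and
   [s = 0], and then [f = 0] everywhere. *)
split=> [|wn]; first by rewrite wE; lra.
have SR0 : S / r%:R = 0.
  apply/eqP; rewrite eq_le SR andbT; move: wE; rewrite wn; lra.
have sn0 : s * n%:R = 0.
  apply/eqP; rewrite eq_le ns andbT; move: wE; rewrite wn; lra.
have s00 : s = 0.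
  by apply/eqP; move/eqP: sn0; rewrite mulf_eq0 pnatr_eq0 -[n == 0]leqn0 leqNgt n0 orbF.
have hz x : h x = 0.
  apply: (@psumr_eq0P _ _ xpredT h) => //.
  by apply/eqP; move/eqP: SR0; rewrite mulf_eq0 invr_eq0 [_%:R == 0]gt_eqF// orbF.
have gz x : g x = 0.
  apply: (@psumr_eq0P _ _ xpredT g) => //; apply/eqP.
  by rewrite eq_le sumr_ge0// andbT; lra.
have fz x : f x = 0.
  have : - f x - s <= g x by rewrite le_max lexx orbT.
  have : r%:R * f x <= h x by rewrite ler_pM2l// le_max lexx orbT.
  rewrite hz gz s00 pmulr_rle0//; lra.
move=> i c d; have := fz (i, c); have := fz (i, d); rewrite /f/=; lra.
Qed.

Lemma expanding_good :
  (exists phi : {set 'I_r * 'I_n} -> R, perfect_fractional_matching H phi) /\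
  (forall w : 'I_r * 'I_n -> R,
     min_weight_fractional_cover H w -> constant_on_blocks w).
Proof.
have rr0 : r%:R != 0 :> R by rewrite pnatr_eq0 -lt0n.
split.
  apply: (@fractional_duality _ _ _ r); rewrite ?card_prod ?card_ord ?muln_gt0 ?r0//.
    by move=> e /(fintype.subsetP HK) /card_transversal.
  move=> w /expanding_cover_weight[+ _]; rewrite natrM mulrAC divff// mul1r.
  exact.
move=> w [wc wmin]; have [wn wconst] := expanding_cover_weight wc.
apply: wconst; apply/eqP; rewrite eq_le wn andbT.
pose i0 := Ordinal r0.
(* The indicator of one block is a cover of weight [n], so a minimum weight cover falls under the
   equality case. *)
pose w1 (x : 'I_r * 'I_n) : R := (x.1 == i0)%:R.
apply: (@le_trans _ _ (weight w1)).
  apply: wmin; split=> [v|e eH]; first by rewrite /w1; case: eqP; rewrite lexx ler01.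
  rewrite (sum_transversal (fun i => (i == i0)%:R) (fintype.subsetP HK _ eH)).
  by rewrite (bigD1 i0)// eqxx/= lerDl sumr_ge0.
rewrite /weight -(pair_big xpredT xpredT (fun i _ => (i == i0)%:R))/= (bigD1 i0)//.
rewrite eqxx/= sumr_const card_ord big1 ?addr0// => i /negbTE ->.
by rewrite sumr_const mul0rn.
Qed.

End ExpandingCover.

(** * The law of the random choices *)

Section KOutProbability.

Variables (R : realType) (V : finType) (H : {set {set V}}) (k : nat).

Lemma kout_choices_neq0 v : (0 < #|kout_choices H k v|)%N.
Proof.
rewrite /kout_choices; case: (ltnP #|edges_at H v| k) => [_|le]; first by rewrite cards1.
by rewrite cards_draws bin_gt0.
Qed.

Lemma kout_choices_sub v S : S \in kout_choices H k v -> S \subset edges_at H v.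
Proof.
rewrite /kout_choices; case: (ltnP #|edges_at H v| k) => _; rewrite inE; last by case/andP.
by move=> /eqP ->.
Qed.

Lemma kout_choice_law_ge0 v S : 0 <= kout_choice_law R H k v S.
Proof. by rewrite /kout_choice_law; case: ifP => // _; rewrite invr_ge0. Qed.

Lemma sum_kout_choice_law v (P : pred {set {set V}}) :
  \sum_(S | P S) kout_choice_law R H k v S =
    #|[set S in kout_choices H k v | P S]|%:R / #|kout_choices H k v|%:R.
Proof.
rewrite -sum1_card natr_sum mulr_suml big_mkcond [RHS]big_mkcond/=.
by apply: eq_bigr => S _; rewrite inE /kout_choice_law mul1r andbC; case: (P S).
Qed.

Lemma kout_law_ge0 E : 0 <= kout_law R H k E.
Proof. by apply: prodr_ge0 => v _; exact: kout_choice_law_ge0. Qed.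

Lemma sum_kout_law (P : V -> pred {set {set V}}) :
  \sum_(E : {ffun V -> {set {set V}}} | [forall v, P v (E v)]) kout_law R H k E =
    \prod_v \sum_(S | P v S) kout_choice_law R H k v S.
Proof.
under eq_bigr do rewrite big_mkcond/=.
rewrite bigA_distr_bigA/= big_mkcond/=; apply: eq_bigr => E _.
case: ifPn => [/forallP EP|]; first by apply: eq_bigr => v _; rewrite EP.
rewrite negb_forall => /existsP[v /negbTE Pv].
by rewrite (bigD1 v)//= Pv mul0r.
Qed.

Lemma sum_kout_law1 : \sum_E kout_law R H k E = 1.
Proof.
transitivity (\sum_(E : {ffun V -> {set {set V}}} | [forall v : V, true]) kout_law R H k E).
  by apply: eq_bigl => E; apply/esym/forallP.
rewrite (sum_kout_law (fun _ _ => true)) big1 // => v _;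
  rewrite sum_kout_choice_law (_ : [set S in _ | _] = kout_choices H k v).
  by rewrite divff// pnatr_eq0 -lt0n kout_choices_neq0.
by apply/setP => S; rewrite !inE andbT.
Qed.

(** Factor by factor, [(b - i) / (N - i) <= b / N] when [b <= N]; falling factorials avoid the
    divisions. *)
Lemma bin_ratio_le b N : (b <= N)%N -> ('C(b, k) * N ^ k <= 'C(N, k) * b ^ k)%N.
Proof.
move=> bN; rewrite -(leq_pmul2r (fact_gt0 k)) -!(mulnAC _ k`!) !bin_ffact.
elim: k => // m IHm; rewrite !ffactnSr !expnSr.
rewrite mulnACA [X in (_ <= X)%N]mulnACA leq_mul//.
by rewrite mulnBl mulnBl [(N * b)%N]mulnC leq_sub2l// leq_mul2l bN orbT.
Qed.

(** With [N] edges at [v] and [k <= N], the probability is ['C(N - |B|, k) / 'C(N, k)]. When [N < k]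
    all edges at [v] are chosen, so [B] is avoided only if empty, and the bound is then [1]. *)
Lemma kout_choice_avoid_le v (B : {set {set V}}) :
  B \subset edges_at H v -> (0 < #|edges_at H v|)%N ->
  \sum_(S : {set {set V}} | [disjoint S & B]) kout_choice_law R H k v S <=
    (1 - #|B|%:R / #|edges_at H v|%:R) ^+ k.
Proof.
move=> BH N0; set N := #|edges_at H v| in N0 *.
have NR0 : 0 < N%:R :> R by rewrite ltr0n.
have BN : (#|B| <= N)%N by rewrite subset_leq_card.
have -> : 1 - #|B|%:R / N%:R = (N - #|B|)%:R / N%:R :> R.
  by rewrite natrB// mulrBl divff// gt_eqF.
rewrite sum_kout_choice_law /kout_choices -/N; case: (ltnP N k) => kN.
  rewrite cards1 divr1.
  have [B0|B0] := eqVneq B finset.set0.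
    rewrite B0 cards0 subn0 divff ?gt_eqF// expr1n lern1.
    by apply: leq_trans (eq_leq (cards1 (edges_at H v)));
      apply/subset_leq_card/fintype.subsetP => S; rewrite inE => /andP[].
  rewrite (_ : [set S in _ | _] = finset.set0) ?cards0 ?exprn_ge0 ?divr_ge0//.
  apply/setP => S; rewrite !inE; apply/negbTE/negP => /andP[/eqP -> dis].
  by move: B0; rewrite -finset.subset0 -(finset.setDv (edges_at H v)) => /negP; apply;
    rewrite finset.subsetD BH disjoint_sym.
rewrite (cards_draws (edges_at H v) k) -/N.
have -> : [set S in [set S0 : {set {set V}} | (S0 \subset edges_at H v) && (#|S0| == k)] |
  [disjoint S & B]]
   = [set S : {set {set V}} | (S \subset edges_at H v :\: B) && (#|S| == k)].
  by apply/setP => S; rewrite !inE finset.subsetD andbAC.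
rewrite cards_draws finset.cardsD (finset.setIidPr BH) -/N.
rewrite expr_div_n ler_pdivrMr ?ltr0n ?bin_gt0// mulrAC ler_pdivlMr ?exprn_gt0//.
by rewrite -!natrX -!natrM ler_nat [X in (_ <= X)%N]mulnC bin_ratio_le// leq_subr.
Qed.

End KOutProbability.

(** * Avoidance probabilities in the complete partite host *)

Section CompletePartite.

Variables (R : realType) (r n : nat).
Implicit Types (A X : {set 'I_r * 'I_n}).

Definition edges_inside A v := [set e in edges_at (complete_partite r n) v | e \subset A].

(** Edges are graphs of functions from blocks to positions; passing through [(i, a)] pins the value
    at [i], and staying in [A] constrains the other values independently. *)
Lemma card_edges_inside A i a : (i, a) \in A ->
  #|edges_inside A (i, a)| = (\prod_(j | j != i) #|[set b | (j, b) \in A]|)%N.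
Proof.
move=> iaA.
pose edge (f : {ffun 'I_r -> 'I_n}) := [set x : 'I_r * 'I_n | f x.1 == x.2].
pose F j := [pred b | ((j, b) \in A) && ((j == i) ==> (b == a))].
have edge_inj : injective edge.
  move=> f g fg; apply/ffunP => j; have : (j, f j) \in edge f by rewrite inE.
  by rewrite fg inE/= => /eqP.
have -> : edges_inside A (i, a) = edge @: [set f | f \in family F].
  apply/setP => e; apply/idP/imsetP => [|[f]].
    rewrite !inE -andbA => /and3P[/forallP eK iae eA].
    have single j : exists b, [set x in e | x.1 == j] = [set (j, b)].
      have /cards1P[[j' b] eE] := eK j.
      exists b; rewrite eE; suff -> : j' = j by [].
      by have := set11 (j', b); rewrite -eE inE => /andP[_ /eqP].
    have [f fP] := fin_all_exists single.
    have fe j : (j, f j) \in e.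
      by have := set11 (j, f j); rewrite -fP inE => /andP[].
    have eE x : (x \in e) = (f x.1 == x.2).
      apply/idP/eqP => [xe|].
        have : x \in [set y in e | y.1 == x.1] by rewrite inE xe eqxx.
        by rewrite fP inE => /eqP ->.
      by case: x => j b /= <-; exact: fe.
    exists (finfun f); last by apply/setP => x; rewrite !inE ffunE.
    rewrite inE; apply/familyP => j; rewrite ffunE inE/= (fintype.subsetP eA)//=.
    by apply/implyP => /eqP ->; have := eE (i, a); rewrite iae => /esym.
  rewrite inE => /familyP fF ->; rewrite !inE/= -andbA; apply/and3P; split.
  - apply/forallP => j; apply/cards1P; exists (j, f j); apply/setP => -[j' b].
    by rewrite !inE/= xpair_eqE andbC; case: (j' =P j) => [->|//]; rewrite eq_sym.
  - by have := fF i; rewrite !inE/= eqxx => /andP[].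
  - by apply/fintype.subsetP => -[j b]; rewrite inE/= => /eqP <-; have := fF j;
      rewrite inE => /andP[].
rewrite card_imset// cardsE card_family foldrE big_map/= big_enum/= (bigD1 i)//=.
rewrite (_ : #|F i| = 1%N) ?mul1n.
  apply: eq_bigr => j /negbTE ji; apply: eq_card => b.
  by rewrite inE ji; apply: andbT.
rewrite -(fintype.card1 a); apply: eq_card => b; rewrite inE eqxx.
suff : ((i, b) \in A) && (b == a) = (b == a) by [].
by case: eqP => [->|_]; rewrite ?andbF// iaA.
Qed.

Lemma edges_inside_ratio A i a : (i, a) \in A ->
  #|edges_inside A (i, a)|%:R / #|edges_at (complete_partite r n) (i, a)|%:R
  = \prod_(j | j != i) (#|[set b | (j, b) \in A]|%:R / n%:R) :> R.
Proof.
move=> iaA.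
have -> : edges_at (complete_partite r n) (i, a) = edges_inside [set: 'I_r * 'I_n]%SET (i, a).
  by apply/setP => e; rewrite [RHS]inE finset.subsetT andbT.
rewrite !card_edges_inside ?inE// prodf_div -!natr_prod; congr (_ / _%:R).
by apply: eq_bigr => j _; rewrite (_ : [set b | _] = [set: 'I_n]%SET) ?cardsT ?card_ord//;
  apply/setP => b; rewrite !inE.
Qed.

Lemma card_edges_at_gt0 v : (0 < n)%N -> (0 < #|edges_at (complete_partite r n) v|)%N.
Proof.
case: v => i a n0; apply: leq_trans (_ : 0 < #|edges_inside [set: 'I_r * 'I_n]%SET (i,
  a)|)%N _.
  rewrite card_edges_inside ?inE// prodn_gt0// => j.
  by apply/card_gt0P; exists a; rewrite !inE.
by apply/subset_leq_card/fintype.subsetP => e; rewrite inE => /andP[].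
Qed.

(** The Weierstrass product inequality; the induction also carries the bounds [0] and [1] on the
    product. *)
Lemma prod_ge_1subsum (I : finType) (P : pred I) (F : I -> R) :
  (forall i, P i -> 0 <= F i <= 1) ->
  1 - \sum_(i | P i) (1 - F i) <= \prod_(i | P i) F i.
Proof.
move=> F01; suff [] : 1 - \sum_(i | P i) (1 - F i) <= \prod_(i | P i) F i /\
                 0 <= \prod_(i | P i) F i <= 1 by [].
elim/big_rec2: _ => [|i p s Pi [le /andP[p0 p1]]]; first by rewrite subr0 lexx ler01.
have /andP[f0 f1] := F01 i Pi.
by split; [nra|apply/andP; split; nra].
Qed.

(** Only the choices made at [X] are inspected, so the event splits over independent choices;
    failure of expansion at [(X, A)] implies it. *)
Definition avoids (E : {ffun 'I_r * 'I_n -> {set {set 'I_r * 'I_n}}}) X A :=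
  [forall v, (v \in X) ==> [disjoint E v & edges_inside A v]].

Lemma prob_avoid_le k X A : (0 < n)%N -> X \subset A ->
  \sum_(E | avoids E X A) kout_law R (complete_partite r n) k E <=
  \prod_(v in X) (1 - \prod_(j | j != v.1) (#|[set b | (j, b) \in A]|%:R / n%:R)) ^+ k.
Proof.
move=> n0 XA; rewrite (sum_kout_law _ _ _ (fun v S => (v \in X) ==>
  [disjoint S & edges_inside A v])).
rewrite [X in _ <= X]big_mkcond/=; apply: ler_prod => -[i a] _.
rewrite sumr_ge0 => [|S _]; last exact: kout_choice_law_ge0.
case: ifPn => vX /=.
  rewrite -(edges_inside_ratio (fintype.subsetP XA _ vX)).
  apply: kout_choice_avoid_le; last exact: card_edges_at_gt0.
  by apply/fintype.subsetP => e; rewrite inE => /andP[].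
rewrite sum_kout_choice_law ler_pdivrMr ?ltr0n ?kout_choices_neq0// mul1r ler_nat.
by apply/subset_leq_card/fintype.subsetP => e; rewrite inE => /andP[].
Qed.

Lemma block_ratio01 A i : 0 <= (#|[set b | (i, b) \in A]|%:R / n%:R : R) <= 1.
Proof.
rewrite divr_ge0//=; case: n A => [|m] A; first by rewrite invr0 mulr0.
by rewrite ler_pdivrMr// mul1r ler_nat -[X in (_ <= X)%N](card_ord m.+1) max_card.
Qed.

(** A random edge at a vertex of [X] leaves [A] with probability at most the sum, over the other
    blocks, of the fractions missing from [A], hence at most [#|~: A| / n]. *)
Lemma prob_avoid_small_le k X A : (0 < n)%N -> X \subset A ->
  \sum_(E | avoids E X A) kout_law R (complete_partite r n) k E <=
  (#|~: A|%:R / n%:R) ^+ (k * #|X|).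
Proof.
move=> n0 XA; apply: le_trans (prob_avoid_le _ n0 XA) _.
rewrite exprM -prodr_const; apply: ler_prod => -[i a] _ /=.
have P01 : 0 <= (\prod_(j | j != i) (#|[set b | (j, b) \in A]|%:R / n%:R) : R) <= 1.
  rewrite prodr_ge0 ?prodr_ile1// => j _; first exact: block_ratio01.
  by have /andP[] := block_ratio01 A j.
rewrite exprn_ge0 ?subr_ge0 ?(andP P01).2//= lerXn2r ?nnegrE ?divr_ge0// ?subr_ge0 ?(andP
  P01).2//.
apply: (@le_trans _ _ (\sum_(j | j != i) (1 - #|[set b | (j, b) \in A]|%:R / n%:R))).
  by rewrite lerBlDr -lerBlDl prod_ge_1subsum// => j _; exact: block_ratio01.
rewrite card_blocks natr_sum mulr_suml [X in _ <= X](bigD1 i)//= -[X in X <= _]add0r.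
rewrite lerD ?divr_ge0// ler_sum// => j _.
rewrite lerBlDr -mulrDl ler_pdivlMr ?ltr0n// mul1r -natrD ler_nat addnC.
rewrite -[X in (X <= _)%N](card_ord n).
rewrite -(cardsC [set b | (j, b) \in A]) leq_add2l subset_leq_card//.
by apply/fintype.subsetP => b; rewrite !inE.
Qed.

(** The [r - 1] other blocks each contribute a factor of at least [1 / M] to the fraction of edges
    staying inside [A]. *)
Lemma prob_avoid_large_le k M A : (0 < n)%N ->
  (forall i, (n <= M * #|[set a | (i, a) \in A]|)%N) ->
  \sum_(E | avoids E A A) kout_law R (complete_partite r n) k E <=
  ((1 - (M ^ r.-1)%:R^-1) ^+ k) ^+ #|A|.
Proof.
move=> n0 nA; apply: le_trans (prob_avoid_le _ n0 (fintype.subxx A)) _.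
rewrite -prodr_const; apply: ler_prod => -[i a] _ /=.
have M0 : (0 < M)%N.
  by have := leq_trans n0 (nA i); rewrite muln_gt0 => /andP[].
have P1 : \prod_(j | j != i) (#|[set b | (j, b) \in A]|%:R / n%:R) <= 1 :> R.
  by apply: prodr_ile1 => j _; exact: block_ratio01.
have PM : (M ^ r.-1)%:R^-1 <= \prod_(j | j != i) (#|[set b | (j, b) \in A]|%:R / n%:R) :> R.
  rewrite natrX -exprVn.
  have -> : r.-1 = #|[pred j : 'I_r | j != i]|.
    by have := cardC1 i; rewrite card_ord => <-; apply: eq_card => j; rewrite !inE.
  rewrite -prodr_const; apply: ler_prod => j _.
  rewrite invr_ge0 ler0n/= ler_pdivlMr ?ltr0n// ler_pdivrMl ?ltr0n//.
  by rewrite -natrM ler_nat.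
rewrite exprn_ge0 ?subr_ge0//= lerXn2r ?nnegrE ?subr_ge0// ?lerD2l ?lerN2//.
exact: le_trans P1.
Qed.

(** Union bound: where [P] fails, the graph is not expanding, so some critical pair is avoided;
    families of zero mass, which may leave the host, are set aside. *)
Lemma kout_prob_expanding_ge k (P : {set {set 'I_r * 'I_n}} -> Prop) :
  (forall G : {set {set 'I_r * 'I_n}}, G \subset complete_partite r n -> expanding G -> P G) ->
  1 - \sum_(p : {set 'I_r * 'I_n} * {set 'I_r * 'I_n} | critical p.1 p.2)
        \sum_(E | avoids E p.1 p.2) kout_law R (complete_partite r n) k E
    <= kout_prob R (complete_partite r n) k P <= 1.
Proof.
move=> expP; set K := complete_partite r n.
have split1 : kout_prob R K k P +
    \sum_(E : {ffun _ -> _} | ~~ `[< P (kout_graph E) >]) kout_law R K k E = 1.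
  by rewrite -(sum_kout_law1 R K k) [RHS](bigID (fun E => `[< P (kout_graph E) >])).
rewrite -[X in _ <= _ <= X]split1 lerDl sumr_ge0 ?andbT => [|E _]; last exact: kout_law_ge0.
rewrite -[X in X - _ <= _]split1 lerBlDr lerD2l.
rewrite (exchange_big_dep xpredT)//= [X in X <= _]big_mkcond/= ler_sum// => E _.
case: ifPn => [/asboolPn nP|_]; last by rewrite sumr_ge0// => p _; exact: kout_law_ge0.
have [->|law_neq0] := eqVneq (kout_law R K k E) 0; first by rewrite sumr_ge0.
have EK v : E v \subset edges_at K v.
  apply: (@kout_choices_sub _ _ k); move: law_neq0; rewrite /kout_law (bigD1 v)//= mulf_eq0.
  by rewrite negb_or /kout_choice_law => /andP[+ _]; case: ifP => //; rewrite eqxx.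
have [/existsP[p pE]|none] := boolP [exists p : {set 'I_r * 'I_n} * {set 'I_r * 'I_n},
  critical p.1 p.2 && avoids E p.1 p.2].
  by rewrite (bigD1 p)//= lerDl sumr_ge0// => q _; exact: kout_law_ge0.
case: nP; apply: expP => [|X A crit].
  apply/bigcupsP => v _; apply: fintype.subset_trans (EK v) _.
  by apply/fintype.subsetP => e; rewrite inE => /andP[].
move: none; rewrite negb_exists => /forallP/(_ (X, A)); rewrite /= crit/=.
rewrite negb_forall => /existsP[v]; rewrite negb_imply => /andP[vX].
move=> /pred0Pn[e /andP[/= eE]]; rewrite inE => /andP[]; rewrite inE => /andP[_ ve] eA.
by exists e, v; split=> //; apply/bigcupP; exists v.
Qed.

End CompletePartite.

(** * Numerical estimates and the sum over critical pairs *)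

(* Both sides are compared with [(2m)^_m = 'C(2m, m) m!]. *)
Lemma exprn_self_le m : (m ^ m <= 4 ^ m * m`!)%N.
Proof.
apply: (@leq_trans ((m + m) ^_ m)).
  rewrite ffact_prod -[X in (_ ^ X <= _)%N]card_ord -prod_nat_const leq_prod// => i _.
  by rewrite -addnBA ?leq_addr// ltnW.
rewrite -bin_ffact leq_mul2r; apply/orP; right.
have -> : (4 ^ m = \sum_(i < (m + m).+1) 'C(m + m, i))%N.
  rewrite -[4%N]/(2 ^ 2)%N -expnM mul2n -addnn -[2%N]/(1 + 1)%N expnDn.
  by apply: eq_bigr => i _; rewrite !exp1n !muln1.
have mm : (m < (m + m).+1)%N by rewrite ltnS leq_addr.
by rewrite (bigD1 (Ordinal mm))//= leq_addr.
Qed.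

(** The classical ['C(N, m) <= (e N / m)^m], with [4] in place of [e] and the denominator
    cleared. *)
Lemma bin_le_exprn N m : (m ^ m * 'C(N, m) <= (4 * N) ^ m)%N.
Proof.
apply: (@leq_trans (4 ^ m * m`! * 'C(N, m))).
  by rewrite leq_mul2r exprn_self_le orbT.
rewrite -mulnA [(m`! * _)%N]mulnC bin_ffact expnMn leq_mul2l; apply/orP; right.
rewrite ffact_prod -[X in (_ <= _ ^ X)%N]card_ord -prod_nat_const leq_prod// => i _.
exact: leq_subr.
Qed.

(** With [x = 1 / L], Bernoulli gives [(1 + x)^L >= 2], while [(1 - x)^L (1 + x)^L <= 1]. *)
Lemma exprn_1subV_le_half (R : realFieldType) (L : nat) : (0 < L)%N ->
  (1 - L%:R^-1) ^+ L <= 2^-1 :> R.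
Proof.
move=> L0; set x : R := L%:R^-1.
have x0 : 0 < x by rewrite invr_gt0 ltr0n.
have x1 : x <= 1 by rewrite invf_le1 ?ltr0n// ler1n.
have bern l : 1 + l%:R * x <= (1 + x) ^+ l.
  elim: l => [|l IHl]; first by rewrite mul0r addr0.
  rewrite exprS; have : 0 <= l%:R * x by rewrite mulr_ge0// ltW.
  by rewrite -natr1; nra.
have two : 2 <= (1 + x) ^+ L.
  by apply: le_trans (bern L); rewrite divff// pnatr_eq0 -lt0n.
have : ((1 - x) * (1 + x)) ^+ L <= 1 by rewrite exprn_ile1//; nra.
rewrite exprMn; have : 0 <= (1 - x) ^+ L by rewrite exprn_ge0// subr_ge0.
rewrite -[2^-1]mul1r ler_pdivlMr//; nra.
Qed.

(* With [y = 2rx/n] the left-hand side is at most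
   [(8r^2 (4r)^(2r) y^(k-2r-1))^x], and the choice of [k] makes this at most
   [(y/(8r))^x = (x/(4n))^x]. *)
Lemma bin_bin_expr_le (R : realFieldType) (r n x k : nat) :
  (0 < r)%N -> (0 < x)%N -> (4 * r * x <= n)%N ->
  (2 * r + 2 + 64 * r ^ 3 * (4 * r) ^ (2 * r) <= k)%N ->
  'C(r * n, x)%:R * ('C(r * n, 2 * r * x)%:R * ((2 * r * x)%:R / n%:R) ^+ (k * x))
    <= n%:R^-1 * 2^-1 ^+ x :> R.
Proof.
move=> r0 x0 xn kr.
have n0 : (0 < n)%N by apply: leq_trans xn; rewrite !muln_gt0 r0.
have rR : 0 < r%:R :> R by rewrite ltr0n.
have xR : 0 < x%:R :> R by rewrite ltr0n.
have nR : 0 < n%:R :> R by rewrite ltr0n.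
set y : R := (2 * r * x)%:R / n%:R.
have y0 : 0 < y by rewrite divr_gt0// ltr0n !muln_gt0 r0.
have y2 : y <= 2^-1.
  rewrite /y ler_pdivrMr// ler_pdivlMl//; rewrite -natrM ler_nat; lia.
have nyx : n%:R / x%:R = 2 * r%:R / y.
  by rewrite /y !natrM; field; rewrite !gt_eqF.
have bin1 : 'C(r * n, x)%:R <= (8 * r%:R ^+ 2 / y) ^+ x.
  have -> : 8 * r%:R ^+ 2 / y = (4 * (r * n))%:R / x%:R.
    by rewrite !natrM -!mulrA nyx; field; rewrite gt_eqF.
  rewrite expr_div_n ler_pdivlMr ?exprn_gt0// -!natrX -natrM ler_nat mulnC.
  exact: bin_le_exprn.
have bin2 : 'C(r * n, 2 * r * x)%:R <= (4 * r%:R / y) ^+ (2 * r * x).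
  have -> : 4 * r%:R / y = (4 * (r * n))%:R / (2 * r * x)%:R.
    by rewrite /y !natrM; field; rewrite !gt_eqF.
  rewrite expr_div_n ler_pdivlMr ?exprn_gt0 ?ltr0n ?muln_gt0 ?r0//.
  by rewrite -!natrX -natrM ler_nat mulnC; exact: bin_le_exprn.
(* [m] is [8r] times the constant collected in [z] below, so [z = m y^(m+1) / (8r)], and [y <= 1/2]
   makes [m y^m <= 1]. *)
set m := (64 * r ^ 3 * (4 * r) ^ (2 * r))%N in kr.
have yk : y ^+ (k * x) <= (y ^+ (2 * r + 2 + m)) ^+ x.
  rewrite exprM; apply: lerXn2r; rewrite ?nnegrE ?exprn_ge0 ?(ltW y0)//.
  by apply: ler_wiXn2l => //; [exact: ltW|lra].
apply: (@le_trans _ _ ((8 * r%:R ^+ 2 / y) ^+ x * ((4 * r%:R / y) ^+ (2 * r * x) * (y ^+ (2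
  * r + 2 + m)) ^+ x))).
  rewrite ler_pM// ?mulr_ge0 ?exprn_ge0 ?(ltW y0)// ler_pM// exprn_ge0//.
  exact: ltW.
rewrite exprM -!exprMn.
set z := (X in X ^+ x <= _).
have zE : z = m%:R / (8 * r%:R) * y ^+ m * y.
  have -> : m%:R = 64 * r%:R ^+ 3 * (4 * r%:R) ^+ (2 * r) :> R.
    by rewrite /m !natrM !natrX natrM.
  rewrite /z expr_div_n !exprD.
  move: (y ^+ m) ((4 * r%:R : R) ^+ (2 * r)) => c d; field.
  by rewrite expf_neq0 ?gt_eqF.
have z0 : 0 <= z by rewrite zE mulr_ge0 ?(ltW y0)// mulr_ge0 ?exprn_ge0 ?(ltW y0)//
  divr_ge0 ?mulr_ge0.
have zle : z <= x%:R / (4 * n%:R).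
  have -> : x%:R / (4 * n%:R) = (8 * r%:R)^-1 * y :> R.
    by rewrite /y !natrM; field; rewrite !gt_eqF.
  rewrite zE ler_pM2r// [_ / _]mulrC -mulrA ler_piMr ?invr_ge0 ?mulr_ge0 ?(ltW rR)//.
  apply: (@le_trans _ _ (m%:R * 2^-1 ^+ m)).
    by rewrite ler_wpM2l// lerXn2r// nnegrE ?(ltW y0)// invr_ge0.
  rewrite exprVn ler_pdivrMr ?exprn_gt0// mul1r -natrX ler_nat.
  by rewrite ltnW// ltn_expl.
apply: (@le_trans _ _ ((x%:R / (4 * n%:R)) ^+ x)).
  by rewrite lerXn2r// nnegrE divr_ge0// mulr_ge0.
(* One factor [2^(-x)] is kept; the other absorbs [x], since [(x/n)^x <= x/n <= 2^x / n]. *)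
have -> : x%:R / (4 * n%:R) = 2^-1 * (2^-1 * (x%:R / n%:R)) :> R.
  by field; rewrite gt_eqF.
rewrite exprMn mulrC ler_wpM2r ?exprn_ge0 ?invr_ge0//.
rewrite exprMn exprVn ler_pdivrMl ?exprn_gt0//.
apply: (@le_trans _ _ (x%:R / n%:R)).
  rewrite -[leRHS]expr1; apply: ler_wiXn2l => //.
    by rewrite divr_ge0.
  rewrite ler_pdivrMr// mul1r ler_nat; apply: leq_trans xn.
  by rewrite leq_pmull// muln_gt0 r0.
by rewrite ler_wpM2r ?invr_ge0// -natrX ler_nat ltnW// ltn_expl.
Qed.

Lemma sum_card_set (R : pzRingType) (T : finType) (F : nat -> R) :
  \sum_(X : {set T}) F #|X| = \sum_(x < #|T|.+1) 'C(#|T|, x)%:R * F x.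
Proof.
have XT (X : {set T}) : (#|X| < #|T|.+1)%N by rewrite ltnS max_card.
rewrite (partition_big (fun X => Ordinal (XT X)) xpredT)//=; apply: eq_bigr => x _.
rewrite (eq_bigr (fun=> F x)) => [|X /eqP <-//].
rewrite sumr_const mulr_natl -card_draws; congr (_ *+ _).
by apply: eq_card => X; rewrite inE.
Qed.

Lemma sum_half_expr_le1 (R : realFieldType) m :
  \sum_(x < m.+1) (0 < x)%N%:R * 2^-1 ^+ x <= 1 :> R.
Proof.
suff -> : \sum_(x < m.+1) (0 < x)%N%:R * 2^-1 ^+ x = 1 - 2^-1 ^+ m :> R.
  by rewrite gerBl exprn_ge0// invr_ge0.
elim: m => [|m IHm]; first by rewrite big_ord1 mul0r subrr.
rewrite big_ord_recr/= {}IHm mul1r exprS.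
have : 2^-1 + 2^-1 = 1 :> R by field.
lra.
Qed.

(** Each kind of critical pair contributes at most [1 / n]: the small sets by summing
    [n^(-1) 2^(-x)] over sizes [x >= 1], the large ones because at most [2^(rn)] sets each have
    probability at most [2^(-(r+1)n)]. *)
Lemma sum_critical_le (R : realType) (r n k : nat) :
  (0 < r)%N -> (0 < n)%N ->
  (2 * r + 2 + 64 * r ^ 3 * (4 * r) ^ (2 * r) <= k)%N ->
  (4 * r ^ 2 * ((4 * r ^ 2) ^ r.-1 * r.+1) <= k)%N ->
  \sum_(p : {set 'I_r * 'I_n} * {set 'I_r * 'I_n} | critical p.1 p.2)
     \sum_(E | avoids E p.1 p.2) kout_law R (complete_partite r n) k E
    <= 2 / n%:R.
Proof.
move=> r0 n0 k1; set M := (4 * r ^ 2)%N; set L := (M ^ r.-1)%N => k2.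
have M0 : (0 < M)%N by rewrite muln_gt0 expn_gt0 r0.
have L0 : (0 < L)%N by rewrite expn_gt0 M0.
pose V := ('I_r * 'I_n)%type.
have cV : #|{: V}| = (r * n)%N by rewrite card_prod !card_ord.
have h0 : 0 <= 2^-1 :> R by rewrite invr_ge0.
have h1 : 2^-1 <= 1 :> R by rewrite invf_le1// ler1n.
pose G x m : R := if [&& 0 < x, 4 * r * x <= n & m == 2 * r * x]%N
  then ((2 * r * x)%:R / n%:R) ^+ (k * x) else 0.
pose b2 (X A : {set V}) : R := (X == A)%:R * 2^-1 ^+ (r.+1 * n).
apply: (@le_trans _ _ (\sum_(p : {set V} * {set V}) (G #|p.1| #|~: p.2| + b2 p.1 p.2))).
  rewrite big_mkcond/= ler_sum// => -[X A] _ /=.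
  have G0 : 0 <= G #|X| #|~: A| by rewrite /G; case: ifP => // _; rewrite exprn_ge0// divr_ge0.
  have b20 : 0 <= b2 X A by rewrite mulr_ge0// exprn_ge0.
  case: ifPn => [|_]; last exact: addr_ge0.
  case/andP => XA /orP[/and3P[X0 Xn /eqP XAc]|/andP[/eqP-> /forallP nA]].
    apply: le_trans (prob_avoid_small_le R k n0 XA) _.
    by rewrite XAc /G card_gt0 X0 Xn eqxx lerDl.
  apply: le_trans (prob_avoid_large_le R k n0 nA) _; rewrite -/M -/L.
  apply: (@le_trans _ _ (b2 A A)); last by rewrite lerDr /G; case: ifP => // _;
    rewrite exprn_ge0// divr_ge0.
  have nMA : (n <= M * #|A|)%N.
    apply: leq_trans (nA (Ordinal r0)) _; rewrite leq_mul2l card_blocks (bigD1 (Ordinal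
      r0))//=.
    by rewrite leq_addr orbT.
  have LV0 : 0 <= 1 - L%:R^-1 :> R by rewrite subr_ge0 invf_le1 ?ltr0n// ler1n.
  rewrite /b2 eqxx mul1r -exprM.
  (* From [n <= M|A|] and the second bound on [k], [L (r+1) n <= k |A|]; each group of [L] factors
     has product at most [1/2]. *)
  apply: (@le_trans _ _ ((1 - L%:R^-1) ^+ (L * (r.+1 * n)))).
    apply: ler_wiXn2l => //; first by rewrite gerBl invr_ge0.
    apply: (@leq_trans (L * r.+1 * (M * #|A|))).
      by rewrite mulnA leq_mul2l nMA orbT.
    by rewrite mulnCA mulnA leq_mul2r k2 orbT.
  rewrite exprM lerXn2r ?nnegrE ?exprn_ge0//.
  exact: exprn_1subV_le_half.
rewrite big_split/= [2]/(1 + 1) mulrDl mul1r; apply: lerD.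
  rewrite -(pair_bigA _ (fun X A : {set V} => G #|X| #|~: A|))/=.
  have -> : \sum_(X : {set V}) \sum_(A : {set V}) G #|X| #|~: A| =
            \sum_(X : {set V}) \sum_(A : {set V}) G #|X| #|A|.
    apply: eq_bigr => X _; rewrite [RHS](reindex_inj (inv_inj (@finset.setCK _)))/=.
    by [].
  rewrite (sum_card_set _ (fun x => \sum_(A : {set V}) G x #|A|)) cV.
  apply: (@le_trans _ _ (\sum_(x < (r * n).+1) n%:R^-1 * ((0 < x)%N%:R * 2^-1 ^+ x)));
    last first.
    by rewrite -mulr_sumr ler_piMr ?invr_ge0// sum_half_expr_le1.
  apply: ler_sum => x _; rewrite sum_card_set cV.
  have [/andP[x0 xn]|/negbTE xP] := boolP ((0 < x) && (4 * r * x <= n))%N; last first.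
    rewrite big1 => [|m _]; first by rewrite mulr0 !mulr_ge0 ?invr_ge0 ?exprn_ge0.
    by rewrite /G andbA xP mulr0.
  have xrn : (2 * r * x < (r * n).+1)%N by rewrite ltnS; nia.
  rewrite (bigD1 (Ordinal xrn))//= big1 ?addr0 => [|m /negbTE mx].
    rewrite /G x0 xn eqxx/= mul1r; exact: bin_bin_expr_le.
  have {}mx : (m == 2 * r * x :> nat)%N = false by rewrite -mx -val_eqE.
  by rewrite /G mx !andbF mulr0.
rewrite -(pair_bigA _ b2)/=.
apply: (@le_trans _ _ (2^-1 ^+ n)).
  have -> : \sum_(X : {set V}) \sum_(A : {set V}) b2 X A = \sum_(X : {set V}) 2^-1 ^+ (r.+1
    * n).
    apply: eq_bigr => X _; rewrite (bigD1 X)//= /b2 eqxx mul1r big1 ?addr0// => A.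
    by rewrite eq_sym => /negbTE ->; rewrite mul0r.
  rewrite sumr_const cardT -cardE -cardsT -powersetT card_powerset cardsT cV.
  rewrite -(mulr_natr (2^-1 ^+ (r.+1 * n))) mulSn exprD -mulrA natrX -exprMn mulVf
    ?pnatr_eq0//.
  by rewrite expr1n mulr1.
rewrite exprVn lef_pV2 ?posrE ?exprn_gt0 ?ltr0n// -natrX ler_nat.
by rewrite ltnW// ltn_expl.
Qed.

Local Open Scope classical_set_scope.

Theorem theorem2 (R : realType) (r : nat) (hr : (0 < r)%N) :
  exists2 k : nat, (0 < k)%N &
    (fun n : nat =>
       kout_prob R (complete_partite r n) k
         (fun H : {set {set 'I_r * 'I_n}} =>
            (exists phi : {set 'I_r * 'I_n} -> R,
               perfect_fractional_matching H phi) /\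
            (forall w : 'I_r * 'I_n -> R,
               min_weight_fractional_cover H w -> constant_on_blocks w)))
      @ \oo --> (1 : R).
Proof.
pose k1 := (2 * r + 2 + 64 * r ^ 3 * (4 * r) ^ (2 * r))%N.
pose k2 := (4 * r ^ 2 * ((4 * r ^ 2) ^ r.-1 * r.+1))%N.
exists (k1 + k2)%N; first by rewrite /k1 addn2.
(* [harmonic n] is [1 / (n + 1)], so [2 / n <= 4 * harmonic n] once [n >= 1]. *)
apply: (@squeeze_cvgr _ _ _ _ (fun n => 1 - 4 * harmonic n) (fun=> 1)).
- near=> n.
  have n0 : (0 < n)%N by near: n; exists 1%N.
  have /andP[ge ->] := kout_prob_expanding_ge R (k1 + k2)
    (fun G GK Gexp => expanding_good R hr n0 GK Gexp).
  rewrite andbT; apply: le_trans ge; rewrite lerD2l lerN2.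
  apply: le_trans (sum_critical_le _ _ _ _ _) _; rewrite ?leq_addr ?leq_addl//.
  rewrite ler_pdivrMr ?ltr0n// mulrAC ler_pdivlMr ?ltr0n//.
  by rewrite -!natrM ler_nat; lia.
- rewrite -[X in _ --> X]subr0 -(mulr0 4).
  by apply: cvgB; [exact: cvg_cst|apply: cvgMr; exact: cvg_harmonic].
- exact: cvg_cst.
Unshelve. all: by end_near.
Qed.
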